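(* The smallest elated number of height $13$ is \[\varepsilon_{13}=8158\times 10^{13888887}-1,\] and the other basic elated numbers of height $13$ less than $8\times 10^{13888891}$ are exactly \[8368890000\times 10^{13888881}-1,\quad 8377800000\times 10^{13888881}-1,\] \[8556000000\times 10^{13888881}-1,\quad\text{and}\quad 8788888889\times 10^{13888881}-1.\]
   Context: All digits are base $10$. For $a\in\mathbb{Z}^+$ with decimal expansion $a=\sum_{i=0}^n a_i10^i$, $0\le a_i\le 9$, leading digit $a_n\ne 0$, let $E_2(a)=a_n\sum_{i=0}^n a_i^2$. A positive integer $a$ is elated if $E_2^m(a)=1$ for some $m\ge 0$ (iteration), and its height is the smallest such $m$. $\varepsilon_k$ denotes the smallest elated number of height $k$. A number is basic if it is greater than $10$ and its non-leading decimal digits are nonzero and in nondecreasing order (read from left to right). *)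

(* Defs.v *)
From Stdlib Require Import NArith List Sorted Decimal DecimalN.
Import ListNotations.
Local Open Scope N_scope.

Fixpoint uint_digits (u : Decimal.uint) : list N :=
  match u with
  | Nil => []
  | D0 v => 0 :: uint_digits v
  | D1 v => 1 :: uint_digits v
  | D2 v => 2 :: uint_digits v
  | D3 v => 3 :: uint_digits v
  | D4 v => 4 :: uint_digits v
  | D5 v => 5 :: uint_digits v
  | D6 v => 6 :: uint_digits v
  | D7 v => 7 :: uint_digits v
  | D8 v => 8 :: uint_digits v
  | D9 v => 9 :: uint_digits v
  end.

(* Most significant digit first; for [0 < a] there is no leading zero. *)
Definition digits (a : N) : list N := uint_digits (N.to_uint a).

Lemma digits_value (a : N) : fold_left (fun x d => 10*x+d) (digits a) 0 = a.
Proof.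
unfold digits. rewrite <- (DecimalN.Unsigned.of_to a) at 2.
generalize (N.to_uint a); intro u.
unfold N.of_uint.
assert (H: forall u p, fold_left (fun x d => 10*x+d) (uint_digits u) (N.pos p) = N.pos (Pos.of_uint_acc u p)).
{ induction u0; intros p; cbn -[N.mul N.add]; try reflexivity; rewrite <- IHu0; f_equal; try (rewrite N.add_comm; reflexivity); try reflexivity. }
induction u; cbn -[N.mul N.add]; try reflexivity; try exact IHu; try (rewrite N.mul_0_r, N.add_0_l; apply H).
Qed.

Definition E2 (a : N) : N :=
  hd 0 (digits a) * fold_right N.add 0 (map (fun d => d ^ 2) (digits a)).

Definition elated (a : N) : Prop := 0 < a /\ exists m, Nat.iter m E2 a = 1.

Definition has_height (a : N) (m : nat) : Prop :=
  Nat.iter m E2 a = 1 /\ forall j, (j < m)%nat -> Nat.iter j E2 a <> 1.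

(* [is_epsilon k e] states that epsilon_k exists and equals [e]. *)
Definition is_epsilon (k : nat) (e : N) : Prop :=
  (elated e /\ has_height e k) /\
  forall b, elated b -> has_height b k -> e <= b.

Definition basic (a : N) : Prop :=
  10 < a /\ Forall (fun d => d <> 0) (tl (digits a)) /\
  Sorted N.le (tl (digits a)).

(* Main.v *)
Require Import Defs.
From Stdlib Require Import NArith List Sorted.
From Stdlib Require Import Bool PeanoNat Lia.
From Stdlib Require Decimal DecimalN DecimalFacts.
Import ListNotations.
Local Open Scope N_scope.

(** Call 81 - d^2 the defect of the digit d. A number with leading digit d and n
    further digits is mapped by [E2] to d (d^2 + 81 n - D), where D is the total
    defect of the further digits; so prescribing the value of [E2] amounts to
    prescribing D. The digit 9 has defect 0 and every other one at least 17, so a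
    small D leaves only a few digits different from 9, however long the number,
    and the question becomes a finite one.

    The numbers are followed backwards from 1. A number [a] in the range of the
    theorem has [E2 a] < 10126000000, and [E2 (E2 a)] is then at most
    7290. Up to that bound exactly six numbers have height 11
    ([height_11], by evaluation). Only 5936 is reached from a number of at most
    ten digits with suitable defect, and this gives the numbers of height 12
    ([height_12]): an 8 followed by three 8s and six 9s in some order. The
    leading digit of [a] divides [E2 a] and has to be 8 or 9 for reasons of
    size, which leaves [E2 a] = 8999999888 and the leading digit 8
    ([height_12_multiple]). Hence the numbers of height 13 in the range are
    exactly those with an 8 followed by 13888890 digits of total defect 168
    ([height_13_iff]).

    It remains to distribute the defect 168. The smallest number uses
    80 + 56 + 32, the digits 1, 5, 7 in the first three places after the 8
    ([height_13_ge]). If the digits are sorted, all but the first nine are 9,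
    and enumeration gives exactly five numbers ([basic_height_13]). *)

(** * Decimal expansions as digit lists *)

Definition value (l : list N) : N := fold_left (fun x d => 10 * x + d) l 0.

Definition digit_list (l : list N) : Prop := Forall (fun d => d <= 9) l.

Lemma fold_value x l :
  fold_left (fun x d => 10 * x + d) l x = x * 10 ^ N.of_nat (length l) + value l.
Proof.
  unfold value; revert x; induction l as [|d l IH]; intros x.
  - cbn [length fold_left]. rewrite N.pow_0_r. lia.
  - cbn [fold_left length]. rewrite IH, (IH (10 * 0 + d)), Nat2N.inj_succ, N.pow_succ_r'. lia.
Qed.

Lemma value_app l1 l2 :
  value (l1 ++ l2) = value l1 * 10 ^ N.of_nat (length l2) + value l2.
Proof. unfold value at 1. rewrite fold_left_app. apply fold_value. Qed.

Lemma value_cons d l : value (d :: l) = d * 10 ^ N.of_nat (length l) + value l.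
Proof. apply (value_app [d] l). Qed.

Lemma value_lt l : digit_list l -> value l < 10 ^ N.of_nat (length l).
Proof.
  induction 1 as [|d l Hd _ IH]; [reflexivity|].
  cbn [length]. rewrite value_cons, Nat2N.inj_succ, N.pow_succ_r'. nia.
Qed.

Lemma value_nines k : value (repeat 9 k) + 1 = 10 ^ N.of_nat k.
Proof.
  induction k as [|k IH]; [reflexivity|].
  cbn [repeat]. rewrite value_cons, repeat_length, Nat2N.inj_succ, N.pow_succ_r'. lia.
Qed.

Lemma value_app_nines p k :
  value (p ++ repeat 9 k) = (value p + 1) * 10 ^ N.of_nat k - 1.
Proof.
  rewrite value_app, repeat_length. pose proof (value_nines k). lia.
Qed.

Lemma value_8_app_nines p k :
  value (8 :: p ++ repeat 9 k) = (value (8 :: p) + 1) * 10 ^ N.of_nat k - 1.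
Proof. apply (value_app_nines (8 :: p)). Qed.

Lemma digit_list_app_nines p k : digit_list p -> digit_list (p ++ repeat 9 k).
Proof.
  intros Hp. apply Forall_app; split; [assumption|]. apply Forall_forall.
  intros x Hx. apply repeat_spec in Hx. lia.
Qed.

Lemma sorted_app_nines p k : digit_list p -> Sorted N.le p -> Sorted N.le (p ++ repeat 9 k).
Proof.
  intros Hp HS. induction HS as [|x p HS IH Hhd].
  - cbn [app]. induction k as [|k IHk]; cbn [repeat]; constructor; [assumption|].
    destruct k; cbn [repeat]; constructor; lia.
  - inversion Hp; subst. cbn. constructor; [now apply IH|].
    destruct Hhd; cbn; [|now constructor].
    destruct k; cbn; constructor; assumption.
Qed.

Lemma uint_digits_digit_list u : digit_list (uint_digits u).
Proof. induction u; cbn; constructor; solve [assumption | lia]. Qed.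

Lemma uint_digits_head_nonzero u :
  Decimal.unorm u = u -> u <> Decimal.D0 Decimal.Nil -> hd 1 (uint_digits u) <> 0.
Proof.
  intros Hu Hz. destruct u; cbn; try lia.
  unfold Decimal.unorm in Hu. destruct (Decimal.nzhead (Decimal.D0 u)) eqn:E; try discriminate.
  - now elim Hz.
  - elim (DecimalFacts.nzhead_nonzero _ _ E).
Qed.

Lemma digits_cons a :
  a <> 0 ->
  exists d r, digits a = d :: r /\ 1 <= d <= 9 /\ digit_list r /\ a = value (d :: r).
Proof.
  intros Ha. unfold digits.
  assert (Hn : Decimal.unorm (N.to_uint a) = N.to_uint a).
  { rewrite <- DecimalN.Unsigned.to_of. now rewrite DecimalN.Unsigned.of_to. }
  assert (Hz : N.to_uint a <> Decimal.D0 Decimal.Nil).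
  { intros E. apply Ha. rewrite <- (DecimalN.Unsigned.of_to a), E. reflexivity. }
  pose proof (uint_digits_head_nonzero _ Hn Hz) as Hh.
  pose proof (uint_digits_digit_list (N.to_uint a)) as Hd.
  pose proof (digits_value a) as Hv. unfold digits in Hv.
  destruct (uint_digits (N.to_uint a)) as [|d r].
  - cbn in Hv. now elim Ha.
  - inversion Hd; subst. cbn in Hh. exists d, r. repeat split; auto; lia.
Qed.

Lemma value_snoc l d : value (l ++ [d]) = 10 * value l + d.
Proof. unfold value. now rewrite fold_left_app. Qed.

Lemma value_pos l : hd 1 l <> 0 -> l <> [] -> 0 < value l.
Proof.
  destruct l as [|d l]; [easy|]. cbn [hd]; intros Hd _. rewrite value_cons.
  assert (0 < 10 ^ N.of_nat (length l)) by (apply N.neq_0_lt_0, N.pow_nonzero; lia).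
  nia.
Qed.

(** The last digit is the residue modulo 10 and the rest is the quotient, so
    the digits are recovered from the right. *)
Lemma value_inj l1 : forall l2,
  digit_list l1 -> digit_list l2 -> hd 1 l1 <> 0 -> hd 1 l2 <> 0 ->
  value l1 = value l2 -> l1 = l2.
Proof.
  induction l1 as [|d1 l1 IH] using rev_ind; intros l2 H1 H2 N1 N2 E.
  - destruct l2 as [|d l]; [easy|].
    pose proof (value_pos (d :: l) N2 ltac:(discriminate)). rewrite <- E in H. now cbn in H.
  - destruct l2 as [|d2 l2 _] using rev_ind.
    { pose proof (value_pos (l1 ++ [d1]) N1) as Hp. rewrite E in Hp.
      destruct l1; cbn in Hp; exfalso; assert (0 < 0) by (apply Hp; discriminate); lia. }
    apply Forall_app in H1, H2. destruct H1 as [H1 D1], H2 as [H2 D2].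
    inversion D1; subst; inversion D2; subst.
    rewrite !value_snoc in E.
    assert (d1 = d2 /\ value l1 = value l2) as [-> E'] by lia.
    f_equal. apply IH; auto.
    + destruct l1; cbn in *; [lia|assumption].
    + destruct l2; cbn in *; [lia|assumption].
Qed.

Lemma digits_value_cons d r :
  1 <= d <= 9 -> digit_list r -> digits (value (d :: r)) = d :: r.
Proof.
  intros Hd Hr.
  assert (Hp : 0 < value (d :: r)) by (apply value_pos; [cbn; lia | discriminate]).
  destruct (digits_cons (value (d :: r))) as (d' & r' & E & Hd' & Hr' & V); [lia|].
  rewrite E. symmetry. apply value_inj; auto; try (constructor; [lia|assumption]); cbn; lia.
Qed.

(** * Defects *)

Definition sumsq (l : list N) : N := fold_right N.add 0 (map (fun d => d ^ 2) l).

(** How far the sum of squares falls short of the one of equally many nines. *)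
Definition defect (l : list N) : N := fold_right N.add 0 (map (fun d => 81 - d ^ 2) l).

Lemma E2_digits a d r : digits a = d :: r -> E2 a = d * (d ^ 2 + sumsq r).
Proof. intros E. unfold E2. now rewrite E. Qed.

Lemma sumsq_defect l : digit_list l -> sumsq l + defect l = 81 * N.of_nat (length l).
Proof.
  unfold sumsq, defect.
  induction 1 as [|d l Hd _ IH]; [reflexivity|]. cbn [map fold_right length].
  assert (d ^ 2 <= 81) by (rewrite N.pow_2_r; nia). lia.
Qed.

Lemma defect_cons d l : defect (d :: l) = (81 - d ^ 2) + defect l.
Proof. reflexivity. Qed.

Lemma defect_app l1 l2 : defect (l1 ++ l2) = defect l1 + defect l2.
Proof.
  unfold defect. rewrite map_app, fold_right_app.
  induction l1 as [|d l1 IH]; cbn [map fold_right]; [reflexivity|]. rewrite IH. lia.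
Qed.

Lemma defect_nines k : defect (repeat 9 k) = 0.
Proof. induction k as [|k IH]; [reflexivity|]. cbn [repeat]. rewrite defect_cons, IH. reflexivity. Qed.

Lemma digit_cases d :
  d <= 9 -> d = 9 \/ In d [0; 1; 2; 3; 4; 5; 6; 7; 8].
Proof. intros; cbn; lia. Qed.

Lemma digit_in d : d <= 9 -> In d [0; 1; 2; 3; 4; 5; 6; 7; 8; 9].
Proof. intros; cbn; lia. Qed.

Lemma digit_defect_ge d : d <= 9 -> d <> 9 -> 17 <= 81 - d ^ 2.
Proof. intros H1 H2. assert (d ^ 2 <= 64) by (rewrite N.pow_2_r; nia). lia. Qed.

Lemma defect_0 l : digit_list l -> defect l = 0 -> l = repeat 9 (length l).
Proof.
  induction 1 as [|d l Hd _ IH]; [reflexivity|].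
  rewrite defect_cons. intros E. cbn [length repeat].
  destruct (N.eq_dec d 9) as [->|H9]; [f_equal; apply IH; lia|].
  pose proof (digit_defect_ge d Hd H9). lia.
Qed.

Lemma sorted_nines d l : digit_list l -> Sorted N.le (d :: l) -> 9 <= d -> l = repeat 9 (length l).
Proof.
  intros Hl; revert d. induction Hl as [|x l Hx _ IH]; intros d HS Hd; [reflexivity|].
  inversion HS; subst. inversion H2; subst.
  assert (x = 9) as -> by lia. cbn [length repeat]. f_equal. now apply (IH 9).
Qed.

(** In a sorted list the digits other than 9 come before the nines, and each
    costs at least 17; so a defect below 17 (n + 1) leaves room for at most [n]
    of them. *)
Lemma sorted_tail_nines l : digit_list l -> Sorted N.le l ->
  forall n, defect l <= 17 * N.of_nat n + 16 -> (n <= length l)%nat ->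
  l = firstn n l ++ repeat 9 (length l - n).
Proof.
  induction 1 as [|x l Hx Hl IH]; intros HS n Hdef Hn; [destruct n; [reflexivity|cbn in Hn; lia]|].
  rewrite defect_cons in Hdef.
  destruct n as [|n].
  - cbn [firstn app]. rewrite Nat.sub_0_r. cbn [length repeat].
    destruct (N.eq_dec x 9) as [->|H9].
    + f_equal. now apply (sorted_nines 9).
    + pose proof (digit_defect_ge x Hx H9). lia.
  - cbn [firstn app length Nat.sub]. f_equal. cbn [length] in Hn.
    destruct (N.eq_dec x 9) as [->|H9].
    + rewrite (sorted_nines 9 l Hl HS) at 1 2 by lia. clear - Hn.
      replace (length l) with (n + (length l - n))%nat at 1 2 by lia.
      rewrite repeat_app, firstn_app, repeat_length, Nat.sub_diag, firstn_O, app_nil_r.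
      now rewrite firstn_all2 by (rewrite repeat_length; lia).
    + pose proof (digit_defect_ge x Hx H9). apply IH; [|lia|lia].
      now inversion HS.
Qed.

(** Whether [D] is a sum of at most [fuel] defects of digits other than 9.
    Conditionals replace the boolean connectives, whose two sides would both be
    explored under call-by-value evaluation. *)
Fixpoint attainable (fuel : nat) (D : N) : bool :=
  if D =? 0 then true else
  match fuel with
  | O => false
  | S f => existsb (fun d => if 81 - d ^ 2 <=? D then attainable f (D - (81 - d ^ 2)) else false)
             [0; 1; 2; 3; 4; 5; 6; 7; 8]
  end.

(** Nines contribute nothing, and every other digit at least 17; so the length
    of the list does not matter, only its defect bounds the search depth. *)
Lemma defect_attainable l : digit_list l ->
  forall fuel, defect l <= 17 * N.of_nat fuel -> attainable fuel (defect l) = true.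
Proof.
  induction 1 as [|d l Hd _ IH]; intros fuel Hf.
  - destruct fuel; reflexivity.
  - rewrite defect_cons in *.
    destruct (digit_cases d Hd) as [->|Hin].
    { replace (81 - 9 ^ 2) with 0 in * by reflexivity. rewrite N.add_0_l in *. now apply IH. }
    pose proof (digit_defect_ge d Hd ltac:(cbn in Hin; lia)).
    destruct fuel as [|f]; [lia|].
    cbn [attainable]. destruct (_ =? 0); [reflexivity|]. apply existsb_exists.
    exists d; split; [assumption|].
    replace (81 - d ^ 2 <=? 81 - d ^ 2 + defect l) with true
      by (symmetry; apply N.leb_le; lia).
    replace (81 - d ^ 2 + defect l - (81 - d ^ 2)) with (defect l) by lia.
    apply IH. lia.
Qed.

(** The relation [R] between neighbouring digits is a parameter so that one
    enumeration serves for arbitrary lists ([R] constantly true) and for sorted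
    ones ([R] the order); [p] is the digit on the left. *)
Fixpoint digit_lists (R : N -> N -> bool) (p : N) (n : nat) (D : N) : list (list N) :=
  match n with
  | O => if D =? 0 then [[]] else []
  | S n' =>
      flat_map (fun d => if R p d && (81 - d ^ 2 <=? D)
                         then map (cons d) (digit_lists R d n' (D - (81 - d ^ 2)))
                         else []) [0; 1; 2; 3; 4; 5; 6; 7; 8; 9]
  end.

Lemma digit_lists_complete R l : forall p,
  digit_list l -> Sorted (fun x y => R x y = true) (p :: l) ->
  In l (digit_lists R p (length l) (defect l)).
Proof.
  induction l as [|d l IH]; intros p Hl HS; [now left|].
  inversion Hl as [|? ? Hd Hl']; subst. inversion HS as [|? ? HS' Hhd]; subst.
  inversion Hhd as [|? ? HR]; subst.
  cbn [length digit_lists]. apply in_flat_map. exists d; split.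
  { now apply digit_in. }
  rewrite defect_cons, HR.
  replace (81 - d ^ 2 <=? 81 - d ^ 2 + defect l) with true
    by (symmetry; apply N.leb_le; lia).
  replace (81 - d ^ 2 + defect l - (81 - d ^ 2)) with (defect l) by lia.
  apply in_map. now apply IH.
Qed.

(** * Heights up to 12 *)

Lemma iter_E2_1 m : Nat.iter m E2 1 = 1.
Proof.
  induction m as [|m IH]; [reflexivity|].
  cbn [Nat.iter nat_rect]. unfold Nat.iter in IH. rewrite IH. reflexivity.
Qed.

Lemma has_height_succ a m : has_height a (S m) <-> a <> 1 /\ has_height (E2 a) m.
Proof.
  unfold has_height. rewrite Nat.iter_succ_r. split.
  - intros [H1 H2]. split; [exact (H2 O ltac:(lia))|]. split; [assumption|].
    intros j Hj. rewrite <- Nat.iter_succ_r. apply H2. lia.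
  - intros (Ha & H1 & H2). split; [assumption|].
    intros [|j] Hj; [assumption|]. rewrite Nat.iter_succ_r. apply H2. lia.
Qed.

(** As 1 is a fixed point, the iterates before the [m]-th differ from 1 as soon as the
    [m]-th does. *)
Lemma has_height_succ_iff a m :
  has_height a (S m) <-> Nat.iter m E2 a <> 1 /\ E2 (Nat.iter m E2 a) = 1.
Proof.
  split; intros [H1 H2].
  - split; [apply H2; lia | exact H1].
  - split; [exact H2|]. intros j Hj E. apply H1.
    replace m with ((m - j) + j)%nat by lia. rewrite Nat.iter_add, E. apply iter_E2_1.
Qed.

Definition has_height_succb (m : nat) (a : N) : bool :=
  let y := Nat.iter m E2 a in negb (y =? 1) && (E2 y =? 1).

Lemma has_height_succbP a m : has_height a (S m) <-> has_height_succb m a = true.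
Proof.
  rewrite has_height_succ_iff. unfold has_height_succb.
  rewrite Bool.andb_true_iff, Bool.negb_true_iff, N.eqb_neq, N.eqb_eq. reflexivity.
Qed.

Lemma has_height_nonzero a m : has_height a m -> a <> 0.
Proof.
  intros [H _] ->. assert (E : Nat.iter m E2 0 = 0); [|congruence].
  clear H. induction m as [|m IH]; [reflexivity|].
  cbn [Nat.iter nat_rect]. unfold Nat.iter in IH. rewrite IH. reflexivity.
Qed.

Lemma elated_of_height a m : has_height a m -> elated a.
Proof.
  intros H. split; [pose proof (has_height_nonzero _ _ H); lia|].
  exists m. apply H.
Qed.

(** The bound is the largest value of [E2] on numbers of ten digits, attained at
    ten nines; numbers of height 12 in the range of interest lead below it. *)
Lemma height_11 c :
  c < 7291 -> has_height c 11 -> In c [5369; 5396; 5639; 5693; 5936; 5963].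
Proof.
  intros Hc Hh. apply has_height_succbP in Hh.
  assert (H : filter (has_height_succb 10) (map N.of_nat (seq 0 (N.to_nat 7291)))
              = [5369; 5396; 5639; 5693; 5936; 5963]) by (vm_compute; reflexivity).
  rewrite <- H. apply (proj2 (filter_In _ _ _)). split; [|assumption].
  apply in_map_iff. exists (N.to_nat c). split; [apply N2Nat.id|].
  apply in_seq. lia.
Qed.

Ltac case_digit d :=
  assert (d = 1 \/ d = 2 \/ d = 3 \/ d = 4 \/ d = 5 \/ d = 6 \/ d = 7 \/ d = 8 \/ d = 9)
    as Hcases by lia;
  destruct Hcases as [->|[->|[->|[->|[->|[->|[->|[->| ->]]]]]]]].

(** A sum of squares of nine digits is at most 729, so a leading digit up to 6
    gives at most 6 (36 + 729) = 4590, below every value of height 11. Of the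
    leading digits 7, 8, 9, divisibility leaves 7 with 5369 or 5936 and 8 with
    5936. As 5936 / 7 - 49 exceeds 729, there remain nine further digits of
    defect 11 or 51, and 11 is less than the defect 17 of the digit 8. Any bound
    on [b] between 9 * 81 * 13888891 and 2 * 10^10 would do: it covers the values
    of [E2] in the range of the theorem, and an eleven-digit [b] begins with 1,
    so that its [E2] is too small. *)
Lemma height_12 b :
  b < 10126000000 -> has_height b 12 ->
  exists r, b = value (8 :: r) /\ In r (digit_lists (fun _ _ => true) 0 9 51).
Proof.
  intros Hb Hh. pose proof (has_height_nonzero _ _ Hh) as Hb0.
  destruct (digits_cons b Hb0) as (d & r & Ed & Hd & Hr & V).
  apply has_height_succ in Hh. destruct Hh as [_ Hh].
  rewrite (E2_digits _ _ _ Ed) in Hh.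
  pose proof (sumsq_defect r Hr) as Hs.
  set (n := N.of_nat (length r)) in *.
  assert (Hn : n <= 9 \/ n = 10 /\ d = 1).
  { rewrite V, value_cons in Hb. fold n in Hb.
    destruct (N.le_gt_cases n 9) as [|H10]; [now left|right].
    destruct (N.le_gt_cases n 10) as [|H11].
    - assert (n = 10) as E by lia. rewrite E in Hb. split; [assumption|].
      change (10 ^ 10) with 10000000000 in Hb. lia.
    - assert (10 ^ 11 <= 10 ^ n) by (apply N.pow_le_mono_r; lia).
      change (10 ^ 11) with 100000000000 in *. nia. }
  assert (Hc : d * (d ^ 2 + sumsq r) < 7291).
  { destruct Hn as [Hn|[Hn ->]]; [|change (1 ^ 2) with 1; lia].
    case_digit d; rewrite N.pow_2_r; lia. }
  pose proof (height_11 _ Hc Hh) as Hin.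
  assert (Hcase : d = 8 /\ n = 9 /\ defect r = 51 \/ defect r = 11).
  { clear - Hin Hn Hd Hs. rewrite N.pow_2_r in Hin. cbn [In] in Hin.
    destruct Hn as [Hn|[Hn ->]]; [|lia].
    case_digit d; lia. }
  destruct Hcase as [(-> & Hn9 & Hdef)|Hdef].
  - exists r. split; [assumption|].
    replace 9%nat with (length r) by (unfold n in Hn9; lia). rewrite <- Hdef.
    apply digit_lists_complete; [assumption|].
    clear. generalize 0. induction r as [|x r IH]; intros p; constructor; auto.
  - pose proof (defect_attainable r Hr 1 ltac:(lia)) as H. rewrite Hdef in H. discriminate H.
Qed.

(** The 84 numbers of height 12 in this range are an 8 followed by an arrangement of three 8s and
    six 9s. Their digit sum 86 excludes divisibility by 9, and divisibility by 8
    forces the last three digits to be 888. *)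
Lemma height_12_multiple b :
  b < 10126000000 -> has_height b 12 ->
  8888999999 <= b /\ ((8 | b) \/ (9 | b) -> b = 8999999888 /\ ~ (9 | b)).
Proof.
  intros Hb Hh. destruct (height_12 b Hb Hh) as (r & -> & Hin).
  assert (H : forallb (fun r => let v := value (8 :: r) in
                (8888999999 <=? v) &&
                (negb ((v mod 8 =? 0) || (v mod 9 =? 0)) ||
                 (v =? 8999999888) && negb (v mod 9 =? 0)))
              (digit_lists (fun _ _ => true) 0 9 51) = true) by (vm_compute; reflexivity).
  pose proof (proj1 (forallb_forall _ _) H r Hin) as Hr. cbv beta zeta in Hr.
  generalize dependent (value (8 :: r)). intros v _ _ Hv.
  rewrite <- !N.Lcm0.mod_divide.
  apply andb_prop in Hv. destruct Hv as [H1 H2]. apply N.leb_le in H1.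
  split; [assumption|]. intros Hdiv.
  apply orb_prop in H2. destruct H2 as [H2|H2].
  - apply negb_true_iff, orb_false_iff in H2. rewrite !N.eqb_neq in H2. tauto.
  - apply andb_prop in H2. rewrite N.eqb_eq, negb_true_iff, N.eqb_neq in H2. assumption.
Qed.

(** * Height 13 *)

(** The image [b] of [a] has height 12, so it is at least 8888999999; a leading
    digit up to 7 cannot produce that much, hence the leading digit is 8 or 9. It
    divides [b], which forces 8 and [b] = 8999999888. The squares of the other
    digits then add up to 8999999888 / 8 - 64 = 1124999922, so there are at
    least 13888888 of them, and at most 13888890 in the given range. Their
    defect is 6, 87 or 168, depending on their number, and neither 6 nor 87 is
    a sum of defects of digits.

    Here and below [k] is a variable equal to 13888881, which keeps [10 ^ k] a
    symbolic factor. *)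
Lemma height_13_iff k a :
  N.of_nat k = 13888881 -> a < 80000000000 * 10 ^ N.of_nat k ->
  has_height a 13 <->
  exists r, a = value (8 :: r) /\ digit_list r /\ length r = (9 + k)%nat /\ defect r = 168.
Proof.
  intros Hk Ha. split.
  - intros Hh. pose proof (has_height_nonzero _ _ Hh) as Ha0.
    destruct (digits_cons a Ha0) as (d & r & Ed & Hd & Hr & V).
    apply has_height_succ in Hh. destruct Hh as [_ Hh].
    rewrite (E2_digits _ _ _ Ed) in Hh.
    pose proof (sumsq_defect r Hr) as Hs.
    assert (Hn : N.of_nat (length r) <= 13888890 \/
                 N.of_nat (length r) = 13888891 /\ d <= 7).
    { rewrite V, value_cons in Ha.
      remember (N.of_nat (length r)) as n eqn:En.
      destruct (N.le_gt_cases n (9 + N.of_nat k)) as [|H1]; [left; lia|right].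
      remember (10 ^ N.of_nat k) as P eqn:EP.
      assert (HP : P <> 0) by (subst P; apply N.pow_nonzero; lia).
      destruct (N.eq_dec n (10 + N.of_nat k)) as [E|H2].
      - rewrite E, N.pow_add_r, <- EP in Ha.
        change (10 ^ 10) with 10000000000 in Ha. split; [lia|nia].
      - assert (HE : 10 ^ (11 + N.of_nat k) <= 10 ^ n) by (apply N.pow_le_mono_r; lia).
        rewrite N.pow_add_r, <- EP in HE.
        change (10 ^ 11) with 100000000000 in HE. nia. }
    assert (Hb : d * (d ^ 2 + sumsq r) < 10126000000).
    { rewrite N.pow_2_r. destruct Hn as [Hn|[Hn Hd7]]; case_digit d; lia. }
    destruct (height_12_multiple _ Hb Hh) as [Hlow Hdiv].
    assert (Hd8 : d = 8 \/ d = 9).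
    { rewrite N.pow_2_r in Hlow. clear - Hlow Hn Hd Hs.
      destruct Hn as [Hn|[Hn Hd7]]; case_digit d; lia. }
    assert (Hself : (d | d * (d ^ 2 + sumsq r))) by apply N.divide_factor_l.
    destruct Hd8 as [-> | ->].
    2: { destruct Hdiv as [_ H9]; [now right|]. now elim H9. }
    destruct Hdiv as [E _]; [now left|].
    change (8 ^ 2) with 64 in E.
    exists r. split; [assumption|]. split; [assumption|].
    assert (Hdef : defect r = 168 /\ N.of_nat (length r) = 13888890 \/
                   defect r = 87 \/ defect r = 6) by lia.
    destruct Hdef as [[Hdef Hlen]|[Hdef|Hdef]]; [split; [lia|assumption]| |];
      exfalso; pose proof (defect_attainable r Hr 6 ltac:(lia)) as H;
      rewrite Hdef in H; vm_compute in H; discriminate H.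
  - intros (r & V & Hr & Hlen & Hdef).
    assert (Ed : digits a = 8 :: r) by (rewrite V; apply digits_value_cons; [lia|assumption]).
    apply has_height_succ. split.
    + intros E1. rewrite E1 in Ed. discriminate Ed.
    + rewrite (E2_digits _ _ _ Ed). pose proof (sumsq_defect r Hr) as Hs.
      replace (sumsq r) with 1124999922 by lia.
      apply has_height_succbP. vm_compute. reflexivity.
Qed.

Lemma has_height_13_intro k p :
  N.of_nat k = 13888881 -> digit_list p -> length p = 9%nat -> defect p = 168 ->
  has_height ((value (8 :: p) + 1) * 10 ^ N.of_nat k - 1) 13 /\
  (value (8 :: p) + 1) * 10 ^ N.of_nat k - 1 < 80000000000 * 10 ^ N.of_nat k.
Proof.
  intros Hk Hp Hlen Hdef.
  assert (Hlt : (value (8 :: p) + 1) * 10 ^ N.of_nat k - 1 < 80000000000 * 10 ^ N.of_nat k).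
  { assert (HP : 10 ^ N.of_nat k <> 0) by (apply N.pow_nonzero; lia).
    pose proof (value_lt p Hp) as Hv. rewrite value_cons, Hlen in *.
    change (10 ^ N.of_nat 9) with 1000000000 in *. nia. }
  split; [|assumption].
  apply (height_13_iff k); [assumption..|].
  exists (p ++ repeat 9 k). rewrite value_8_app_nines, length_app, repeat_length, Hlen.
  rewrite defect_app, defect_nines, Hdef.
  repeat split. now apply digit_list_app_nines.
Qed.

Lemma basic_intro k p :
  digit_list p -> Sorted N.le p -> Forall (fun d => d <> 0) p -> length p = 9%nat ->
  basic ((value (8 :: p) + 1) * 10 ^ N.of_nat k - 1).
Proof.
  intros Hp HS Hnz Hlen. unfold basic. rewrite <- value_8_app_nines.
  rewrite digits_value_cons; [|lia|now apply digit_list_app_nines].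
  cbn [tl]. split; [|split].
  - rewrite value_8_app_nines, value_cons, Hlen.
    assert (HP : 10 ^ N.of_nat k <> 0) by (apply N.pow_nonzero; lia).
    change (10 ^ N.of_nat 9) with 1000000000. nia.
  - apply Forall_app; split; [assumption|]. apply Forall_forall.
    intros x Hx. apply repeat_spec in Hx. lia.
  - now apply sorted_app_nines.
Qed.

(** A number below 8158 * 10^13888887 of the shape just found has its first four
    digits at most 8157. Among the possible three digits after the 8, only 157
    leave a defect that other digits can make up, and it leaves none: the rest
    are nines, which is the claimed minimum itself. *)
Lemma height_13_ge k a :
  N.of_nat k = 13888881 -> has_height a 13 -> 8158000000 * 10 ^ N.of_nat k - 1 <= a.
Proof.
  intros Hk Hh.
  destruct (N.lt_ge_cases a (80000000000 * 10 ^ N.of_nat k)) as [Ha|Ha]; [|lia].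
  apply (height_13_iff k a Hk Ha) in Hh. destruct Hh as (r & -> & Hr & Hlen & Hdef).
  destruct r as [|x [|y [|z q]]]; try discriminate Hlen.
  inversion Hr as [|? ? Hx Hr1]; subst. inversion Hr1 as [|? ? Hy Hr2]; subst.
  inversion Hr2 as [|? ? Hz Hq]; subst. clear Hr Hr1 Hr2 Ha.
  assert (Hlq : length q = (6 + k)%nat) by (cbn in Hlen; lia).
  assert (HE : 8158000000 * 10 ^ N.of_nat k = 8158 * 10 ^ N.of_nat (length q)).
  { rewrite Hlq, Nat2N.inj_add, N.pow_add_r. change (10 ^ N.of_nat 6) with 1000000. lia. }
  rewrite HE. change (8 :: x :: y :: z :: q) with ([8; x; y; z] ++ q).
  rewrite value_app.
  set (v := value [8; x; y; z]).
  destruct (N.le_gt_cases 8158 v) as [Hv|Hv]; [nia|].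
  set (w := (81 - x ^ 2) + (81 - y ^ 2) + (81 - z ^ 2)).
  assert (Hw : w + defect q = 168) by (rewrite !defect_cons in Hdef; unfold w; lia).
  pose proof (defect_attainable q Hq 10 ltac:(lia)) as Hatt.
  replace (defect q) with (168 - w) in Hatt by lia.
  assert (Hcheck : forallb (fun x => forallb (fun y => forallb (fun z =>
             let w := (81 - x ^ 2) + (81 - y ^ 2) + (81 - z ^ 2) in
             let v := value [8; x; y; z] in
             if (8158 <=? v) || (169 <=? w) then true
             else if attainable 10 (168 - w) then (v =? 8157) && (w =? 168) else true)
             [0;1;2;3;4;5;6;7;8;9]) [0;1;2;3;4;5;6;7;8;9]) [0;1;2;3;4;5;6;7;8;9] = true)
    by (vm_compute; reflexivity).
  rewrite forallb_forall in Hcheck. specialize (Hcheck x (digit_in x Hx)).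
  rewrite forallb_forall in Hcheck. specialize (Hcheck y (digit_in y Hy)).
  rewrite forallb_forall in Hcheck. specialize (Hcheck z (digit_in z Hz)).
  cbv zeta in Hcheck. fold w v in Hcheck. rewrite Hatt in Hcheck.
  replace (8158 <=? v) with false in Hcheck by (symmetry; apply N.leb_gt; lia).
  replace (169 <=? w) with false in Hcheck by (symmetry; apply N.leb_gt; lia).
  apply andb_prop in Hcheck. rewrite !N.eqb_eq in Hcheck. destruct Hcheck as [Hv' Hw'].
  rewrite (defect_0 q Hq) by lia. rewrite repeat_length.
  pose proof (value_nines (length q)). rewrite Hv'. lia.
Qed.

(** Sortedness confines the digits other than 9 to the first nine places after
    the 8, since ten of them would cost at least 170 > 168; what remains is a
    finite enumeration. *)
Lemma basic_height_13 k a :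
  N.of_nat k = 13888881 -> a < 80000000000 * 10 ^ N.of_nat k -> basic a -> has_height a 13 ->
  exists p, a = (value (8 :: p) + 1) * 10 ^ N.of_nat k - 1 /\
    In p [[1;5;7;9;9;9;9;9;9]; [3;6;8;8;8;9;9;9;9]; [3;7;7;7;9;9;9;9;9];
          [5;5;5;9;9;9;9;9;9]; [7;8;8;8;8;8;8;8;8]].
Proof.
  intros Hk Ha (_ & _ & HS) Hh.
  apply (height_13_iff k a Hk Ha) in Hh. destruct Hh as (r & -> & Hr & Hlen & Hdef).
  rewrite digits_value_cons in HS by (lia || assumption). cbn [tl] in HS.
  pose proof (sorted_tail_nines r Hr HS 9 ltac:(lia) ltac:(lia)) as E.
  assert (Hl9 : length (firstn 9 r) = 9%nat) by (rewrite length_firstn; lia).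
  replace (length r - 9)%nat with k in E by lia.
  generalize dependent (firstn 9 r). intros p E Hl9. subst r.
  exists p. split; [apply value_8_app_nines|].
  apply Forall_app in Hr. destruct Hr as [Hp _].
  rewrite defect_app, defect_nines, N.add_0_r in Hdef.
  assert (HSp : Sorted (fun x y => (x <=? y) = true) (0 :: p)).
  { clear - HS. constructor.
    - induction p as [|x p IH]; [constructor|].
      inversion HS as [|? ? HS' Hhd]; subst. constructor; [now apply IH|].
      destruct p; constructor. inversion Hhd; subst. now apply N.leb_le.
    - destruct p; constructor. apply N.leb_le. lia. }
  pose proof (digit_lists_complete N.leb p 0 Hp HSp) as Hin.
  rewrite Hl9, Hdef in Hin.
  assert (Hcomp : digit_lists N.leb 0 9 168 =
    [[1;5;7;9;9;9;9;9;9]; [3;6;8;8;8;9;9;9;9]; [3;7;7;7;9;9;9;9;9];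
     [5;5;5;9;9;9;9;9;9]; [7;8;8;8;8;8;8;8;8]]) by (vm_compute; reflexivity).
  rewrite <- Hcomp. exact Hin.
Qed.

Lemma height_13_summary k :
  N.of_nat k = 13888881 ->
  is_epsilon 13 (8158000000 * 10 ^ N.of_nat k - 1) /\
  forall a : N,
    (basic a /\ elated a /\ has_height a 13 /\
     a < 80000000000 * 10 ^ N.of_nat k /\ a <> 8158000000 * 10 ^ N.of_nat k - 1) <->
    (a = 8368890000 * 10 ^ N.of_nat k - 1 \/
     a = 8377800000 * 10 ^ N.of_nat k - 1 \/
     a = 8556000000 * 10 ^ N.of_nat k - 1 \/
     a = 8788888889 * 10 ^ N.of_nat k - 1).
Proof.
  intros Hk.
  assert (HP : 10 ^ N.of_nat k <> 0) by (apply N.pow_nonzero; lia).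
  split; [split; [split|]|].
  - apply (elated_of_height _ 13).
    apply (has_height_13_intro k [1;5;7;9;9;9;9;9;9] Hk); [repeat constructor; lia|reflexivity..].
  - apply (has_height_13_intro k [1;5;7;9;9;9;9;9;9] Hk); [repeat constructor; lia|reflexivity..].
  - intros b _ Hb. now apply height_13_ge.
  - intros a. split.
    + intros (Hbas & _ & Hh & Ha & Hne).
      destruct (basic_height_13 k a Hk Ha Hbas Hh) as (p & E & Hin).
      cbn [In] in Hin.
      destruct Hin as [<-|[<-|[<-|[<-|[<-|[]]]]]]; cbn in E; tauto.
    + assert (Hconv : forall p, digit_list p -> Sorted N.le p -> Forall (fun d => d <> 0) p ->
        length p = 9%nat -> defect p = 168 -> value (8 :: p) <> 8157999999 ->
        a = (value (8 :: p) + 1) * 10 ^ N.of_nat k - 1 ->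
        basic a /\ elated a /\ has_height a 13 /\
        a < 80000000000 * 10 ^ N.of_nat k /\ a <> 8158000000 * 10 ^ N.of_nat k - 1).
      { intros p Hp HS Hnz Hlen Hdef Hv ->.
        destruct (has_height_13_intro k p Hk Hp Hlen Hdef) as [Hh Hlt].
        split; [now apply basic_intro|]. split; [now apply (elated_of_height _ 13)|].
        split; [assumption|]. split; [assumption|]. nia. }
      intros [E|[E|[E|E]]];
        [ apply (Hconv [3;6;8;8;8;9;9;9;9]) | apply (Hconv [3;7;7;7;9;9;9;9;9])
        | apply (Hconv [5;5;5;9;9;9;9;9;9]) | apply (Hconv [7;8;8;8;8;8;8;8;8]) ];
        try exact E; try reflexivity; try discriminate; repeat constructor; lia.
Qed.

Theorem theorem20 :
  is_epsilon 13 (8158 * 10 ^ 13888887 - 1) /\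
  forall a : N,
    (basic a /\ elated a /\ has_height a 13 /\
     a < 8 * 10 ^ 13888891 /\ a <> 8158 * 10 ^ 13888887 - 1) <->
    (a = 8368890000 * 10 ^ 13888881 - 1 \/
     a = 8377800000 * 10 ^ 13888881 - 1 \/
     a = 8556000000 * 10 ^ 13888881 - 1 \/
     a = 8788888889 * 10 ^ 13888881 - 1).
Proof.
  (* All powers are reduced to one factor [10 ^ 13888881], which is then hidden
     behind a variable exponent so that nothing ever evaluates it. *)
  assert (Hm : 13888887 = 6 + 13888881) by reflexivity.
  assert (Hn : 13888891 = 10 + 13888881) by reflexivity.
  rewrite Hm, Hn, !N.pow_add_r, !N.mul_assoc. clear Hm Hn.
  replace (8158 * 10 ^ 6) with 8158000000 by reflexivity.
  replace (8 * 10 ^ 10) with 80000000000 by reflexivity.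
  assert (Hk : exists k, N.of_nat k = 13888881) by (exists (N.to_nat 13888881); apply N2Nat.id).
  destruct Hk as [k Hk]. rewrite <- Hk.
  now apply height_13_summary.
Qed.
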